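(* Let $\mathfrak P$ be a reproducing kernel Pontryagin space of $\mathbb C^p$-valued functions, with reproducing kernel $K(z,w)$, analytic in an open set $\Omega$ symmetric with respect to the real line and intersecting it, and assume that there is a point $\alpha\in\Omega$, $\alpha\ne\overline\alpha$, such that both $K(\alpha,\alpha)$ and $K(\overline\alpha,\overline\alpha)$ are invertible. Assume that the following condition holds for every $F,G\in\mathfrak P$: if $F(v)=G(v)=0$ for some $v\in\Omega$ with $v\neq\overline v$, then the functions $z\mapsto\frac{z-\overline v}{z-v}F(z)$ and $z\mapsto\frac{z-\overline v}{z-v}G(z)$ belong to $\mathfrak P$ and $$[F(z),G(z)]=\left[\frac{z-\overline v}{z-v}F(z),\frac{z-\overline v}{z-v}G(z)\right].$$ Then there exist $\mathbb C^{p\times p}$-valued functions $E_+$ and $E_-$ and a signature matrix $J\in\mathbb C^{p\times p}$, with the same signature as $K(\alpha,\alpha)$, such that the reproducing kernel of $\mathfrak P$ is of the form $$K(z,w)=\frac{E_+(z)JE_+(w)^*-E_-(z)JE_-(w)^*}{-i(z-\overline w)}.$$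
   Context: A signature matrix is a matrix $J$ with $J=J^*=J^{-1}$. $[\cdot,\cdot]$ is the indefinite inner product of $\mathfrak P$. *)

(* Defs.v *)
From mathcomp Require Import all_boot all_order all_algebra complex.
From mathcomp Require Import all_classical all_reals all_analysis.

Set Implicit Arguments.
Unset Strict Implicit.
Unset Printing Implicit Defensive.

Import Order.TTheory GRing.Theory Num.Theory.
Import numFieldNormedType.Exports.

Local Open Scope classical_set_scope.
Local Open Scope ring_scope.
Local Open Scope sesquilinear_scope.

Section IndefiniteInnerProduct.
Variables (C : numClosedFieldType) (V : lmodType C).
Implicit Types (P : set V) (ip : V -> V -> C).

Definition linear_subspace P :=
  P 0 /\ forall a u v, P u -> P v -> P (a *: u + v).

Definition hermitian_form_on P ip :=
  (forall a u v w, P u -> P v -> P w ->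
     ip (a *: u + v) w = a * ip u w + ip v w) /\
  (forall u v, P u -> P v -> ip u v = (ip v u)^*).

Definition complete_on P ip :=
  let nrm u := sqrtC (ip u u) in
  forall x : nat -> V, (forall n, P (x n)) ->
  (forall e : C, 0 < e -> exists N, forall m n, (N <= m)%N -> (N <= n)%N ->
     nrm (x m - x n) < e) ->
  exists2 l, P l &
    forall e : C, 0 < e -> exists N, forall n, (N <= n)%N -> nrm (x n - l) < e.

Definition hilbert_space P ip :=
  [/\ linear_subspace P, hermitian_form_on P ip,
      forall u, P u -> u <> 0 -> 0 < ip u u & complete_on P ip].

Definition finite_dimensional P :=
  exists n (e : 'I_n -> V), (forall i, P (e i)) /\
    forall u, P u -> exists a : 'I_n -> C, u = \sum_i a i *: e i.

(* The sum of Pp and Pm is direct because the form is positive definite on Pp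
   and negative definite on Pm. Only the negative index is assumed finite. *)
Definition pontryagin_space P ip :=
  [/\ linear_subspace P, hermitian_form_on P ip &
      exists Pp Pm : set V,
        [/\ P = [set u + v | u in Pp & v in Pm],
            forall u v, Pp u -> Pm v -> ip u v = 0,
            hilbert_space Pp ip,
            hilbert_space Pm (fun u v => - ip u v) &
            finite_dimensional Pm]].

End IndefiniteInnerProduct.

Section Kernels.
Variables (C : numClosedFieldType) (p : nat).
Implicit Types (Omega : set C) (F : C -> 'cV[C]_p).

(* A function on Omega is encoded by its extension by zero to all of C. *)
Definition zero_ext Omega F : C -> 'cV[C]_p := patch (fun=> 0) Omega F.

Definition analytic_in Omega F :=
  forall z : C, Omega z -> derivable (F : C^o -> 'cV[C]_p) z 1.

Record rk_pontryagin_space Omega (P : set (C -> 'cV[C]_p))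
    (ip : (C -> 'cV[C]_p) -> (C -> 'cV[C]_p) -> C)
    (K : C -> C -> 'M[C]_p) : Prop := RKPontryaginSpace {
  rkp_support : forall F, P F -> zero_ext Omega F = F;
  rkp_pontryagin : pontryagin_space P ip;
  rkp_kernel : forall w (c : 'cV[C]_p), Omega w ->
    P (zero_ext Omega (fun z => K z w *m c));
  rkp_reproducing : forall F w (c : 'cV[C]_p), P F -> Omega w ->
    ip F (zero_ext Omega (fun z => K z w *m c)) = (c^t* *m F w) 0 0 }.

(* The function z |-> (z - v^* ) / (z - v) F(z). It is used only when F is
   analytic at v and F v = 0; its value at v is then given by removing the
   singularity. *)
Definition zero_shift (v : C) F : C -> 'cV[C]_p := fun z =>
  if z == v then lim (((x - v^*) / (x - v)) *: F x @[x --> v^'])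
  else ((z - v^*) / (z - v)) *: F z.

End Kernels.

Section Signature.
Variables (C : numClosedFieldType) (n : nat).
Implicit Types A J : 'M[C]_n.

Definition signature_matrix J := [/\ J \in unitmx, J^t* = J & invmx J = J].

(* Numbers of positive and of negative eigenvalues, counted with multiplicity:
   for normal A, spectral_diag A is the diagonal of a unitary
   diagonalization of A. *)
Definition signature A : nat * nat :=
  (#|[pred i | 0 < spectral_diag A 0 i]|, #|[pred i | spectral_diag A 0 i < 0]|).

End Signature.

(* The complex numbers, with the structure from which the topology, the
   derivative and the order are inferred. *)
Definition Cnum (R : realType) : numClosedFieldType := R[i].

(* Main.v *)
Require Import Defs.
From mathcomp Require Import all_boot all_order perm all_algebra complex.
From mathcomp Require Import all_classical all_reals all_analysis.
From mathcomp Require Import ring.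

Set Implicit Arguments.
Unset Strict Implicit.
Unset Printing Implicit Defensive.

Import Order.TTheory GRing.Theory Num.Theory.
Import numFieldNormedType.Exports.

Local Open Scope classical_set_scope.
Local Open Scope ring_scope.
Local Open Scope sesquilinear_scope.

(** Write [b] for [a^*]. Let [P_v] be the space of those [F] in [P] that vanish
    at [v]; when [K v v] is invertible, its reproducing kernel is
    [K_v(z, w) = K(z, w) - K(z, v) K(v, v)^-1 K(v, w)].  The hypothesis on [P]
    says that multiplication by [(z - b) / (z - a)] is an isometry from [P_a]
    into [P_b], and applied at [b] it provides the inverse isometry.  A unitary
    multiplication operator between two reproducing kernel spaces transforms
    the kernels by conjugation ([vanishing_kernel_shift]):
      [(z - b)(w^* - a) K_a(z, w) = (z - a)(w^* - b) K_b(z, w)].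
    As [(z - a)(w^* - b) - (z - b)(w^* - a) = (a - b)(z - w^* )], solving this
    equation for [K(z, w)] yields ([kernel_identity])
      [(a - b)(z - w^* ) K(z, w) = (z - a)(w^* - b) K(z, b) K(b, b)^-1 K(b, w)
                                 - (z - b)(w^* - a) K(z, a) K(a, a)^-1 K(a, w)].
    Both terms on the right have the form [E(z) J E(w)^*] as soon as the
    invertible Hermitian matrices [K(a, a)^-1] and [K(b, b)^-1] are congruent to
    one and the same diagonal sign matrix [J]; the sign of ['i (a - b)] decides
    which of the two terms is the positive one.

    What remains is that [K(a, a)] and [K(b, b)] have the same number of
    negative eigenvalues, which for invertible matrices fixes the whole
    signature.  This is a count of negative dimensions: [P] is the
    orthogonal sum of [P_v] and of the space of all [K(., v) c], on which the
    form is given by the matrix [K(v, v)], so that the negative index of [P] is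
    that of [P_v] plus that of [K(v, v)], while [P_a] and [P_b] are isometric.
    As the negative index of [P] is finite, it may be cancelled
    ([kernel_negative_index]). *)

(** * Inertia of Hermitian matrices *)

Section Inertia.
Variable C : numClosedFieldType.

Lemma adjmxM m n q (A : 'M[C]_(m, n)) (B : 'M[C]_(n, q)) :
  (A *m B)^t* = B^t* *m A^t*.
Proof. by rewrite trmx_mul map_mxM. Qed.

Lemma adjmxB m n (A B : 'M[C]_(m, n)) : (A - B)^t* = A^t* - B^t*.
Proof. by rewrite linearB /= map_mxB. Qed.

Lemma adjmxZ m n (a : C) (A : 'M[C]_(m, n)) : (a *: A)^t* = a^* *: A^t*.
Proof. by rewrite linearZ /= map_mxZ. Qed.

Lemma adjmx_inv n (A : 'M[C]_n) : (invmx A)^t* = invmx (A^t*).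
Proof. by rewrite trmx_inv map_invmx. Qed.

Definition qform p (H : 'M[C]_p) (u : 'cV[C]_p) : C := (u^t* *m H *m u) 0 0.

Lemma qform_congr p (H X : 'M[C]_p) u :
  qform (X^t* *m H *m X) u = qform H (X *m u).
Proof. by rewrite /qform adjmxM !mulmxA. Qed.

Lemma qform_diag p (d : 'rV[C]_p) y :
  qform (diag_mx d) y = \sum_i d 0 i * `|y i 0| ^+ 2.
Proof.
rewrite /qform mxE; apply: eq_bigr => i _.
by rewrite mul_mx_diag !mxE normCKC mulrAC mulrC.
Qed.

Lemma hermitian_spectral p (H : 'M[C]_p) : H^t* = H ->
  [/\ H = (spectralmx H)^t* *m diag_mx (spectral_diag H) *m spectralmx H &
      forall i, spectral_diag H 0 i \is Num.real].
Proof.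
move=> Hh; have hH : H \is hermsymmx.
  by rewrite is_hermitianmxE expr0 scale1r Hh.
split; last by move=> i; exact: (mxOverP (hermitian_spectral_diag_real hH)).
rewrite -(invmx_unitary (spectral_unitarymx H)).
exact/orthomx_spectralP/hermitian_normalmx.
Qed.

(** The columns of [M] are eigenvectors for the negative eigenvalues.  Together
    with the next lemma this determines the number of negative eigenvalues
    without reference to a particular diagonalization. *)
Lemma negative_vectors p (H : 'M[C]_p) : H^t* = H ->
  exists M : 'M[C]_(p, (signature H).2),
    forall c, c != 0 -> qform H (M *m c) < 0.
Proof.
move=> /hermitian_spectral[defH _]; rewrite /signature /=.
set d := spectral_diag H in defH *; set U := spectralmx H in defH.
have UU : U *m U^t* = 1%:M by apply/unitarymxP/spectral_unitarymx.
set S := [pred i | d 0 i < 0].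
pose E : 'M[C]_(p, #|S|) := \matrix_(i, j) (i == enum_val j)%:R.
have EE c j : (E *m c) (enum_val j) 0 = c j 0.
  rewrite mxE (bigD1 j) //= mxE eqxx mul1r big1 ?addr0 // => k kj.
  by rewrite mxE (inj_eq enum_val_inj) eq_sym (negPf kj) mul0r.
have E0 c i : i \notin S -> (E *m c) i 0 = 0.
  move=> iS; rewrite mxE big1 // => k _; rewrite mxE.
  case: eqP => [ik|]; rewrite ?mul0r //.
  by move: iS; rewrite ik enum_valP.
exists (U^t* *m E) => c c0; rewrite defH qform_congr !mulmxA UU mul1mx.
have [j cj0] : exists j, c j 0 != 0.
  apply/existsP; apply: contraNT c0; rewrite negb_exists => /forallP c0.
  by apply/eqP/colP => j; rewrite mxE; apply/eqP; rewrite -[_ == _]negbK c0.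
rewrite qform_diag (bigD1 (enum_val j)) //= EE.
rewrite -[ltRHS]addr0 ltr_leD //.
  by rewrite pmulr_llt0 ?exprn_gt0 ?normr_gt0 //; exact: (enum_valP j).
apply: sumr_le0 => i _; have [iS|iS] := boolP (i \in S).
  by rewrite mulr_le0_ge0 ?exprn_ge0 // ltW.
by rewrite E0 // normr0 expr0n mulr0.
Qed.

(** [L] takes the coordinates along the negative eigenvectors. *)
Lemma nonneg_on_kernel p (H : 'M[C]_p) : H^t* = H ->
  exists L : 'M[C]_((signature H).2, p),
    forall u, L *m u = 0 -> 0 <= qform H u.
Proof.
move=> /hermitian_spectral[defH dreal]; rewrite /signature /=.
set d := spectral_diag H in defH dreal *; set U := spectralmx H in defH.
set S := [pred i | d 0 i < 0].
exists (\matrix_(j, i) U (enum_val (A := S) j) i) => u Lu0.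
rewrite defH qform_congr qform_diag sumr_ge0 // => i _.
have [iS|iS] := boolP (i \in S).
  suff -> : (U *m u) i 0 = 0 by rewrite normr0 expr0n mulr0.
  have := congr1 (fun M : 'cV_#|S| => M (enum_rank_in iS i) 0) Lu0.
  rewrite !mxE => {2}<-; apply: eq_bigr => j _.
  by rewrite mxE enum_rankK_in.
rewrite mulr_ge0 ?exprn_ge0 //.
by rewrite real_leNgt ?dreal ?real0.
Qed.

Lemma mx_nontrivial_kernel m n (A : 'M[C]_(m, n)) : (m < n)%N ->
  exists2 c : 'cV[C]_n, c != 0 & A *m c = 0.
Proof.
move=> mn; exists (nz_row (kermx A^T))^T.
  rewrite trmx_eq0 nz_row_eq0 -mxrank_eq0 mxrank_ker subn_eq0 -ltnNge.
  by rewrite mxrank_tr (leq_ltn_trans (rank_leq_row _)).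
apply: trmx_inj; rewrite trmx_mul trmxK trmx0.
by apply/sub_kermxP/nz_row_sub.
Qed.

(** By rank-nullity, [n] linear conditions leave at least [k] of [k + n]
    dimensions. *)
Lemma mx_kernel_injection n k (A : 'M[C]_(n, k + n)) :
  exists R : 'M[C]_(k + n, k),
    A *m R = 0 /\ forall c : 'cV_k, R *m c = 0 -> c = 0.
Proof.
pose B := row_base (kermx A^T).
have rk : (k <= \rank (kermx A^T))%N.
  rewrite mxrank_ker mxrank_tr.
  by apply: leq_trans (leq_sub2l _ (rank_leq_row A)); rewrite addnK.
exists (pid_mx k *m B)^T; split=> [|c].
  apply: trmx_inj; rewrite trmx_mul trmxK trmx0; apply/sub_kermxP.
  by rewrite (submx_trans (submxMl _ _)) // eq_row_base.
move/(congr1 trmx); rewrite trmx_mul trmxK trmx0 => cB0; apply: trmx_inj.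
rewrite trmx0; apply/eqP; rewrite -mxrank_eq0.
have fB : row_free ((pid_mx k : 'M[C]_(k, \rank (kermx A^T))) *m B).
  by rewrite /row_free (mxrankMfree _ (row_base_free _)) rank_pid_mx.
by rewrite -(mxrankMfree _ fB) cB0 mxrank0.
Qed.

Lemma card_ord_ltn p n : (n <= p)%N -> #|[pred i : 'I_p | (i < n)%N]| = n.
Proof.
move=> np; rewrite -sum1_card (eq_bigl (fun i : 'I_p => (i < n)%N)) //.
by rewrite (big_ord_narrow np) sum1_card card_ord.
Qed.

(** If [X^t* *m H *m X] had fewer negative eigenvalues than [H], a nonzero
    combination of the negative vectors of [H] would satisfy all the conditions
    that force the form to be nonnegative. *)
Lemma signature_congr_le p (H X : 'M[C]_p) : H^t* = H -> X \in unitmx ->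
  ((signature H).2 <= (signature (X^t* *m H *m X)).2)%N.
Proof.
move=> Hh Xu; have [M MP] := negative_vectors Hh.
have [|L LP] := @nonneg_on_kernel _ (X^t* *m H *m X).
  by rewrite !adjmxM trmxCK Hh mulmxA.
rewrite leqNgt; apply/negP => /(mx_nontrivial_kernel (L *m invmx X *m M)).
move=> [c c0 LMc]; case/negP: (negbT (lt_geF (MP _ c0))).
by rewrite -[M *m c](mulKVmx Xu) -qform_congr LP // !mulmxA.
Qed.

Lemma signature_unit p (H : 'M[C]_p) : H^t* = H -> H \in unitmx ->
  ((signature H).1 + (signature H).2)%N = p.
Proof.
move=> /hermitian_spectral[defH dreal]; rewrite /signature /=.
set d := spectral_diag H in defH dreal *; rewrite defH !unitmx_mul.
move=> /andP[/andP[_ du] _].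
have d0 i : d 0 i != 0.
  move: du; rewrite unitmxE det_diag unitfE => /prodf_neq0; exact.
rewrite addnC -[RHS]card_ord -(cardC [pred i | d 0 i < 0]); congr addn.
by apply: eq_card => i; rewrite !inE real_ltNge ?real0 // le_eqVlt (negPf (d0 i)).
Qed.

(** Sylvester's law of inertia. *)
Lemma signature_congr p (H X : 'M[C]_p) : H^t* = H -> H \in unitmx ->
  X \in unitmx -> signature (X^t* *m H *m X) = signature H.
Proof.
move=> Hh Hu Xu; set H' := X^t* *m H *m X.
have Xsu : X^t* \in unitmx by rewrite map_unitmx unitmx_tr.
have H'h : H'^t* = H' by rewrite !adjmxM trmxCK Hh mulmxA.
have H'u : H' \in unitmx by rewrite !unitmx_mul Xsu Hu.
have e2 : (signature H').2 = (signature H).2.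
  apply/eqP; rewrite eqn_leq signature_congr_le // andbT.
  rewrite -[X in (_ <= (signature X).2)%N](_ :
    (invmx X)^t* *m H' *m invmx X = _) ?signature_congr_le ?unitmx_inv //.
  by rewrite /H' adjmx_inv !mulmxA mulVmx // mul1mx mulmxK.
have e1 : (signature H').1 = (signature H).1.
  apply: (@addIn (signature H).2).
  by rewrite -{1}e2 !signature_unit.
by rewrite (surjective_pairing (signature H')) e1 e2 -surjective_pairing.
Qed.

(** The canonical representative of the signature matrices with [n] negative
    eigenvalues: fixing one of them per [n] makes the two halves of the kernel
    formula share the same [J]. *)
Definition sign_mx p n : 'M[C]_p :=
  diag_mx (\row_(i < p) (-1) ^+ (i < n)%N).

Lemma sign_mx_adj p n : (sign_mx p n)^t* = sign_mx p n.
Proof.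
rewrite tr_diag_mx map_diag_mx; congr diag_mx; apply/rowP => i.
by rewrite !mxE rmorph_sign.
Qed.

Lemma sign_mx_sqr p n : sign_mx p n *m sign_mx p n = 1%:M.
Proof.
rewrite mulmx_diag -diag_const_mx; congr diag_mx; apply/rowP => i.
by rewrite !mxE -expr2 sqrr_sign.
Qed.

Lemma sign_mx_signature p n : signature_matrix (sign_mx p n).
Proof.
have [Ju _] := mulmx1_unit (sign_mx_sqr p n); split=> //.
  exact: sign_mx_adj.
by rewrite -[LHS]mulmx1 -(sign_mx_sqr p n) mulKmx.
Qed.

(** Used to sort the spectrum of a Hermitian matrix so that its negative part
    comes first. *)
Lemma perm_to_initial p (A : pred 'I_p) :
  exists s : 'S_p, forall i, (s i \in A) = (i < #|A|)%N.
Proof.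
pose t := [tuple (i \in A) | i < p].
have [s sE] : exists s : 'S_p,
    [tuple (i < #|A|)%N | i < p] = [tuple tnth t (s i) | i < p] :> seq bool.
  apply/tuple_permP/allP => b _ /=; apply/eqP.
  have cntT (B : pred 'I_p) : count_mem true [seq i \in B | i <- enum 'I_p] = #|B|.
    rewrite count_map -sum1_count big_enum_cond -sum1_card.
    by apply: eq_bigl => i; rewrite /= eqb_id.
  have cntF s : count_mem false s = (size s - count_mem true s)%N.
    rewrite -(count_predC (pred1 true)) addKn.
    by apply: eq_count => -[].
  have cA : count_mem true [seq (i < #|A|)%N | i : 'I_p <- enum 'I_p] = #|A|.
    have Ap : (#|A| <= p)%N by rewrite -[leqRHS]card_ord max_card.
    by rewrite -[RHS](card_ord_ltn Ap) -[RHS]cntT.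
  by case: b; rewrite ?cntF ?size_map cA cntT.
exists s => i; have := congr1 (fun u => tnth u i) (val_inj sE).
by rewrite !tnth_mktuple => ->.
Qed.

(** Absorb into the congruence the square roots of the absolute values of the
    eigenvalues, and the permutation that sorts their signs. *)
Lemma hermitian_congr_sign p (H : 'M[C]_p) : H^t* = H -> H \in unitmx ->
  exists2 X : 'M[C]_p, X \in unitmx & H = X^t* *m sign_mx p (signature H).2 *m X.
Proof.
move=> /hermitian_spectral[defH dreal] Hu; rewrite /signature /=.
set d := spectral_diag H in defH dreal *; set U := spectralmx H in defH.
have [s sP] := perm_to_initial [pred i | d 0 i < 0].
pose X : 'M[C]_p := \matrix_(k, j) (sqrtC `|d 0 (s k)| * U (s k) j).
have HX : H = X^t* *m sign_mx p #|[pred i | d 0 i < 0]| *m X.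
  rewrite {1}defH; apply/matrixP => i j; rewrite mul_mx_diag [LHS]mxE [RHS]mxE.
  rewrite (reindex_inj (@perm_inj _ s)) /=; apply: eq_bigr => k _.
  rewrite mul_mx_diag !mxE -sP inE rmorphM /=.
  rewrite [(sqrtC _)^*]geC0_conj ?sqrtC_ge0 //.
  rewrite [X in _ * X * _]realEsign // -[X in (-1) ^+ _ * X]sqrtCK expr2.
  move: (U _ j) (U _ i)^* (sqrtC _) (_ ^+ _) => x y r e; ring.
exists X => //; move: Hu; rewrite {1}HX unitmx_mul => /andP[] //.
Qed.

(** From [H = X^t* *m J *m X] and [J *m J = 1], the inverse of [H] is
    congruent to the same [J] through [invmx X]. *)
Lemma hermitian_inverse_sign p (H : 'M[C]_p) : H^t* = H -> H \in unitmx ->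
  exists Y : 'M[C]_p, invmx H = Y *m sign_mx p (signature H).2 *m Y^t*.
Proof.
move=> Hh Hu; have [X Xu eH] := hermitian_congr_sign Hh Hu.
exists (invmx X); rewrite adjmx_inv; set J := sign_mx p _ in eH *.
have Xsu : X^t* \in unitmx by rewrite map_unitmx unitmx_tr.
suff HY : H *m (invmx X *m J *m invmx (X^t*)) = 1%:M.
  by rewrite -[RHS](mulKmx Hu) HY mulmx1.
by rewrite eH !mulmxA mulmxK // -(mulmxA _ J J) sign_mx_sqr mulmx1 mulmxV.
Qed.

Lemma hermitian_signature p (H : 'M[C]_p) : H^t* = H -> H \in unitmx ->
  signature (sign_mx p (signature H).2) = signature H.
Proof.
move=> Hh Hu; have [X Xu eH] := hermitian_congr_sign Hh Hu.
rewrite [in RHS]eH signature_congr //; first exact: sign_mx_adj.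
by have [] := sign_mx_signature p (signature H).2.
Qed.

End Inertia.

(** * Negative families in a space with a Hermitian form *)

Section NegativeFamilies.
Variables (C : numClosedFieldType) (V : lmodType C).
Implicit Types (P Q : set V) (ip : V -> V -> C).

Definition combo k (F : 'I_k -> V) (c : 'cV[C]_k) : V := \sum_i c i 0 *: F i.

(** The span of such a family is a negative definite subspace of dimension [k]
    (the family is free, since a vanishing combination would give [0 < 0]), so
    the negative index of [P] is the supremum of these [k]. *)
Definition negative_family P ip k := exists F : 'I_k -> V,
  (forall i, P (F i)) /\
  forall c, c != 0 -> ip (combo F c) (combo F c) < 0.

Lemma combo_comp k l (F : 'I_k -> V) (M : 'M[C]_(k, l)) c :
  combo (fun j => combo F (col j M)) c = combo F (M *m c).
Proof.
rewrite /combo; under eq_bigr do rewrite scaler_sumr.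
rewrite exchange_big /=; apply: eq_bigr => i _.
rewrite mxE scaler_suml; apply: eq_bigr => j _.
by rewrite scalerA mxE mulrC.
Qed.

Lemma combo_split m n (F : 'I_m -> V) (G : 'I_n -> V) c :
  combo (fun i : 'I_(m + n) =>
    match fintype.split i with inl a => F a | inr b => G b end) c
  = combo F (usubmx c) + combo G (dsubmx c).
Proof.
rewrite /combo big_split_ord; congr (_ + _); apply: eq_bigr => i _.
  by rewrite (unsplitK (inl i)) mxE.
by rewrite (unsplitK (inr i)) mxE.
Qed.

Lemma subspace_combo P k (F : 'I_k -> V) c :
  linear_subspace P -> (forall i, P (F i)) -> P (combo F c).
Proof.
move=> [P0 Plin] PF; rewrite /combo.
apply: (big_ind P) => // [u v Pu Pv|i _].
  by rewrite -[u]scale1r; exact: Plin.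
by rewrite -[X in P X]addr0; exact: Plin.
Qed.

Section HermitianForm.
Variables (P : set V) (ip : V -> V -> C).
Hypotheses (Psub : linear_subspace P) (Pherm : hermitian_form_on P ip).

Lemma subspaceD u v : P u -> P v -> P (u + v).
Proof. by move=> Pu Pv; rewrite -[u]scale1r; apply: Psub.2. Qed.

Lemma subspaceZ a u : P u -> P (a *: u).
Proof. by move=> Pu; rewrite -[X in P X]addr0; apply: Psub.2 => //; case: Psub. Qed.

Lemma subspaceB u v : P u -> P v -> P (u - v).
Proof. by move=> Pu Pv; rewrite -scaleN1r addrC; apply: Psub.2. Qed.

Lemma form_addl u v w : P u -> P v -> P w -> ip (u + v) w = ip u w + ip v w.
Proof. by move=> Pu Pv Pw; rewrite -[u]scale1r Pherm.1 // mul1r scale1r. Qed.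

Lemma form_zerol w : P w -> ip 0 w = 0.
Proof.
move=> Pw; have P0 := Psub.1.
by apply: (@addrI _ (ip 0 w)); rewrite -form_addl // !addr0.
Qed.

Lemma form_scalel a u w : P u -> P w -> ip (a *: u) w = a * ip u w.
Proof.
move=> Pu Pw; rewrite -[a *: u]addr0 Pherm.1 ?form_zerol ?addr0 //.
exact: Psub.1.
Qed.

Lemma form_addr u v w : P u -> P v -> P w -> ip w (u + v) = ip w u + ip w v.
Proof.
move=> Pu Pv Pw; rewrite Pherm.2 ?form_addl ?rmorphD //=; last exact: subspaceD.
by rewrite -!Pherm.2.
Qed.

Lemma form_orthD u v : P u -> P v -> ip u v = 0 ->
  ip (u + v) (u + v) = ip u u + ip v v.
Proof.
move=> Pu Pv uv; have Puv := subspaceD Pu Pv.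
by rewrite form_addl ?form_addr // uv [ip v u]Pherm.2 // uv conjC0 addr0 add0r.
Qed.

Lemma form_combo k (F : 'I_k -> V) c : (forall i, P (F i)) ->
  ip (combo F c) (combo F c)
  = \sum_i \sum_j c i 0 * ((c j 0)^* * ip (F i) (F j)).
Proof.
move=> PF; have PcF := subspace_combo c Psub PF.
have suml w (Pw : P w) :
    ip (combo F c) w = \sum_i c i 0 * ip (F i) w.
  have [_ <-] : P (combo F c) /\ ip (combo F c) w = \sum_i c i 0 * ip (F i) w.
    apply: (big_ind2 (fun u x => P u /\ ip u w = x)).
    - by split; [exact: Psub.1 | exact: form_zerol].
    - move=> u x v y [Pu <-] [Pv <-]; split; first exact: subspaceD.
      exact: form_addl.
    - by move=> i _; split; [exact: subspaceZ | exact: form_scalel].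
  by [].
rewrite suml //; apply: eq_bigr => i _; rewrite -mulr_sumr; congr (_ * _).
rewrite Pherm.2 // suml // rmorph_sum /=; apply: eq_bigr => j _.
by rewrite rmorphM [ip (F i) _]Pherm.2.
Qed.

End HermitianForm.

(** With more vectors than the dimension of the negative summand, some nonzero
    combination has no component there, hence lies in the positive summand. *)
Lemma pontryagin_negative_bound P ip : pontryagin_space P ip ->
  exists n, forall k, negative_family P ip k -> (k <= n)%N.
Proof.
move=> [Psub Pherm [Pp [Pm [defP orth Hp _ [n [e [Pe Pspan]]]]]]].
have [Psubp Phermp ppos _] := Hp.
exists n => k [F [PF Fneg]]; rewrite leqNgt; apply/negP => nk.
have /choice[uv uvP] : forall i, exists x : V * ('I_n -> C),
    Pp x.1 /\ F i = x.1 + \sum_j x.2 j *: e j.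
  move=> i; have := PF i; rewrite defP => -[u Pu [v Pv <-]].
  by have [a ->] := Pspan _ Pv; exists (u, a).
pose A : 'M[C]_(n, k) := \matrix_(j, i) (uv i).2 j.
have [c c0 Ac0] := mx_nontrivial_kernel A nk.
have eqF : combo F c = combo (fun i => (uv i).1) c.
  rewrite /combo; under eq_bigr do rewrite (uvP _).2 scalerDr.
  rewrite big_split /= [X in _ + X](_ : _ = 0) ?addr0 //.
  under eq_bigr do rewrite scaler_sumr.
  rewrite exchange_big big1 //= => j _.
  have := congr1 (fun M : 'cV[C]_n => M j 0) Ac0; rewrite !mxE => Ac.
  rewrite -[RHS](scale0r (e j)) -Ac scaler_suml; apply: eq_bigr => i _.
  by rewrite scalerA mxE mulrC.
have Pc : Pp (combo F c).
  by rewrite eqF; apply: subspace_combo => // i; case: (uvP i).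
have := Fneg _ c0; have [->|/eqP nz] := eqVneq (combo F c) 0.
  by rewrite (form_zerol Psub Pherm) ?ltxx //; case: Psub.
by rewrite lt_gtF // ppos.
Qed.

(** The form on the combinations of a family depends only on the Gram matrix of
    that family, which [T] preserves. *)
Lemma negative_family_isometry P Q ip (T : V -> V) k :
  linear_subspace P -> hermitian_form_on P ip ->
  linear_subspace Q -> hermitian_form_on Q ip ->
  (forall u v, P u -> P v -> [/\ Q (T u), Q (T v) & ip u v = ip (T u) (T v)]) ->
  negative_family P ip k -> negative_family Q ip k.
Proof.
move=> Psub Pherm Qsub Qherm PT [F [PF Fneg]]; exists (T \o F); split.
  by move=> i; have [] := PT _ _ (PF i) (PF i).
move=> c /Fneg; rewrite (form_combo Psub) // (form_combo Qsub) //=; last first.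
  by move=> i; have [] := PT _ _ (PF i) (PF i).
congr (_ < _); apply: eq_bigr => i _; apply: eq_bigr => j _.
by have [_ _ ->] := PT _ _ (PF i) (PF j).
Qed.

End NegativeFamilies.

(** * Functions vanishing at a point *)

Section ReproducingKernel.
Variables (C : numClosedFieldType) (p : nat) (Omega : set C).
Variables (P : set (C -> 'cV[C]_p)).
Variables (ip : (C -> 'cV[C]_p) -> (C -> 'cV[C]_p) -> C).
Variable (K : C -> C -> 'M[C]_p).
Hypothesis P_rk : rk_pontryagin_space Omega P ip K.

Let Psub : linear_subspace P.
Proof. by case: (rkp_pontryagin P_rk). Qed.

Let Pherm : hermitian_form_on P ip.
Proof. by case: (rkp_pontryagin P_rk). Qed.

Definition kfun w (c : 'cV[C]_p) : C -> 'cV[C]_p :=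
  zero_ext Omega (fun z => K z w *m c).

Definition vanishing_at v : set (C -> 'cV[C]_p) := [set F | P F /\ F v = 0].

(** For [F] in [P] and [K v v] invertible, the orthogonal projection of [F] onto
    the space of functions that vanish at [v]. *)
Definition kproj v (F : C -> 'cV[C]_p) := F - kfun v (invmx (K v v) *m F v).

Lemma kfunE w c z : Omega z -> kfun w c z = K z w *m c.
Proof. by move=> Oz; rewrite /kfun /zero_ext /patch mem_set. Qed.

Lemma kfun_out w c z : ~ Omega z -> kfun w c z = 0.
Proof. by move=> Oz; rewrite /kfun /zero_ext /patch memNset. Qed.

Lemma kfunP w c : Omega w -> P (kfun w c).
Proof. exact: (rkp_kernel P_rk). Qed.

Lemma reproducing F w c : P F -> Omega w -> ip F (kfun w c) = (c^t* *m F w) 0 0.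
Proof. exact: (rkp_reproducing P_rk). Qed.

Lemma kfun_combo k w (M : 'M[C]_(p, k)) c :
  combo (fun j => kfun w (col j M)) c = kfun w (M *m c).
Proof.
apply/funext => z; rewrite /combo fct_sumE; have [Oz|Oz] := pselect (Omega z).
  rewrite kfunE // mulmxA; apply/colP => i; rewrite summxE mxE.
  apply: eq_bigr => j _; rewrite mxE kfunE // mulrC; congr (_ * _).
  by rewrite colE mulmxA -colE mxE.
rewrite kfun_out // big1 // => j _.
by apply/colP => i; rewrite !mxE kfun_out // mxE mulr0.
Qed.

Lemma combo_at k (F : 'I_k -> C -> 'cV[C]_p) c v :
  combo F c v = \matrix_(i, j) F j v i 0 *m c.
Proof.
apply/colP => i; rewrite /combo fct_sumE summxE mxE; apply: eq_bigr => j _.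
by rewrite !mxE mulrC.
Qed.

Lemma kproj_combo k (F : 'I_k -> C -> 'cV[C]_p) v c :
  combo (fun j => kproj v (F j)) c = kproj v (combo F c).
Proof.
rewrite /kproj combo_at mulmxA -kfun_combo /combo -sumrB.
apply: eq_bigr => j _; rewrite -scalerBr; congr (_ *: (_ - kfun v _)).
rewrite colE -mulmxA -colE; congr (_ *m _).
by apply/colP => i; rewrite !mxE.
Qed.

Lemma mx_sesqui_eq (A B : 'M[C]_p) :
  (forall c d : 'cV[C]_p, (d^t* *m A *m c) 0 0 = (d^t* *m B *m c) 0 0) -> A = B.
Proof.
move=> AB; apply/matrixP => i j.
have E (M : 'M[C]_p) :
    ((delta_mx i 0 : 'cV[C]_p)^t* *m M *m (delta_mx j 0 : 'cV[C]_p)) 0 0 = M i j.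
  by rewrite trmx_delta map_delta_mx -rowE -colE !mxE.
by rewrite -E AB E.
Qed.

Lemma kernel_adj z w : Omega z -> Omega w -> (K w z)^t* = K z w.
Proof.
move=> Oz Ow; apply: mx_sesqui_eq => c d.
have := reproducing d (kfunP c Ow) Oz.
rewrite kfunE // -!mulmxA => <-.
rewrite Pherm.2; [|exact: kfunP..].
rewrite reproducing ?kfunE //; last exact: kfunP.
have -> : d^t* *m ((K w z)^t* *m c) = (c^t* *m (K w z *m d))^t*.
  by rewrite !adjmxM trmxCK mulmxA.
by rewrite !mxE.
Qed.

Lemma kernel_form v c : Omega v -> ip (kfun v c) (kfun v c) = qform (K v v) c.
Proof.
by move=> Ov; rewrite reproducing ?kfunE // ?mulmxA //; exact: kfunP.
Qed.

Lemma vanishing_subspace v : linear_subspace (vanishing_at v).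
Proof.
split=> [|a F G [PF Fv] [PG Gv]]; first by split; [exact: Psub.1|].
split; first exact: Psub.2.
by rewrite !fctE Fv Gv scaler0 addr0.
Qed.

Lemma vanishing_hermitian v : hermitian_form_on (vanishing_at v) ip.
Proof.
by split=> [a F G H [PF _] [PG _] [PH _]|F G [PF _] [PG _]];
  [exact: Pherm.1 | exact: Pherm.2].
Qed.

Lemma vanishing_orth F v c : vanishing_at v F -> Omega v -> ip F (kfun v c) = 0.
Proof. by move=> [PF Fv] Ov; rewrite reproducing // Fv mulmx0 mxE. Qed.

Section Invertible.
Variable v : C.
Hypotheses (Ov : Omega v) (Kv : K v v \in unitmx).

Lemma kproj_vanishing F : P F -> vanishing_at v (kproj v F).
Proof.
move=> PF; split; first by apply: (subspaceB Psub) => //; exact: kfunP.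
by rewrite /kproj !fctE kfunE // mulKVmx // subrr.
Qed.

(** The two components of [F] along [vanishing_at v] and along the functions
    [kfun v c] are orthogonal. *)
Lemma kproj_form F : P F ->
  ip F F = ip (kproj v F) (kproj v F) + qform (K v v) (invmx (K v v) *m F v).
Proof.
move=> PF; have PvF := kproj_vanishing PF; set d := invmx _ *m _.
have {1 2}-> : F = kproj v F + kfun v d by rewrite /kproj subrK.
rewrite (form_orthD Psub Pherm) ?kernel_form ?vanishing_orth //.
- by case: PvF.
- exact: kfunP.
Qed.

(** Adjoin to the family the functions [kfun v c], with [c] running through the
    negative vectors of [K v v]. *)
Lemma negative_family_extend m : negative_family (vanishing_at v) ip m ->
  negative_family P ip (m + (signature (K v v)).2).
Proof.
move=> [F [PF Fneg]]; have [M Mneg] := negative_vectors (kernel_adj Ov Ov).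
exists (fun i => match fintype.split i with
  inl a => F a | inr b => kfun v (col b M) end); split.
  by move=> i; case: (fintype.split i) => a; [case: (PF a)|exact: kfunP].
move=> c c0; rewrite combo_split kfun_combo.
have PvF : vanishing_at v (combo F (usubmx c)).
  by apply: subspace_combo => //; exact: vanishing_subspace.
rewrite (form_orthD Psub Pherm) ?kernel_form ?vanishing_orth //; first last.
- exact: kfunP.
- by case: PvF.
have [u0|u0] := eqVneq (usubmx c) 0; last first.
  apply: (le_lt_trans (y := ip (combo F (usubmx c)) (combo F (usubmx c)) + 0)).
    rewrite lerD2l; have [->|d0] := eqVneq (dsubmx c) 0.
      by rewrite mulmx0 /qform mulmx0 mxE.
    by rewrite ltW ?Mneg.
  by rewrite addr0 Fneg.
have [d0|d0] := eqVneq (dsubmx c) 0.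
  by case/eqP: c0; rewrite -[c]vsubmxK u0 d0 col_mx0.
rewrite u0 [combo F 0]big1 => [|i _]; last by rewrite mxE scale0r.
by rewrite (form_zerol Psub Pherm Psub.1) add0r Mneg.
Qed.

(** Keep the combinations whose component along the functions [kfun v c] has
    nonnegative square, which costs one linear condition for each negative
    eigenvalue of [K v v]; projecting these onto [vanishing_at v] can only make
    the form more negative. *)
Lemma negative_family_restrict k :
  negative_family P ip (k + (signature (K v v)).2) ->
  negative_family (vanishing_at v) ip k.
Proof.
move=> [F [PF Fneg]]; have [L Lpos] := nonneg_on_kernel (kernel_adj Ov Ov).
set n := (signature (K v v)).2 in F PF Fneg L Lpos.
pose E : 'M[C]_(p, k + n) := \matrix_(i, j) F j v i 0.
pose A := L *m (invmx (K v v) *m E).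
have [R [AR Rinj]] := mx_kernel_injection A.
exists (fun j => kproj v (combo F (col j R))); split.
  by move=> j; apply: kproj_vanishing; apply: subspace_combo.
move=> c c0; rewrite kproj_combo combo_comp.
have Rc0 : R *m c != 0 by apply: contra c0 => /eqP/Rinj ->.
have PFc : P (combo F (R *m c)) by exact: subspace_combo.
have := Fneg _ Rc0; rewrite kproj_form //; apply: le_lt_trans.
rewrite lerDl Lpos // combo_at -/E !mulmxA -[in X in X *m _](mulmxA L) -/A.
by rewrite AR mul0mx.
Qed.

End Invertible.

End ReproducingKernel.

(** * The shift and the kernel identity *)

(** The two multipliers are inverse to each other away from [v] and [v^*].  At
    [v] both sides vanish, and at [v^*] the outer shift is a limit, which is
    [F v^*] by continuity. *)
Lemma zero_shift_cancel (C : numClosedFieldType) p (v : C) (F : C -> 'cV[C]_p) :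
  v != v^* -> F v = 0 -> derivable (F : C^o -> 'cV[C]_p) v^* 1 ->
  zero_shift v^* (zero_shift v F) = F.
Proof.
move=> vr Fv0 dF; apply/funext => z; rewrite {1}/zero_shift conjCK.
case: eqP => [->|/eqP zb].
  have cF : F x @[x --> v^*^'] --> F v^*.
    apply: cvg_within_filter; apply: (differentiable_continuous).
    by apply/derivable1_diffP.
  have oV : open (~` [set v]).
    apply: closed_openC; apply: accessible_closed_set1.
    exact: hausdorff_accessible (@norm_hausdorff _ C^o).
  have bV : (~` [set v]) v^* by move=> /= /esym/eqP; apply/negP.
  apply: cvg_lim; first exact: norm_hausdorff.
  apply: cvg_trans cF; apply: near_eq_cvg.
  near=> x; rewrite /zero_shift.
  have xb : x != v^* by near: x; exact: nbhs_dnbhs_neq.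
  have xv : x != v.
    near: x; apply: nbhs_dnbhs; apply: filterS (open_nbhs_nbhs (conj oV bV)).
    by move=> x /eqP.
  rewrite (negPf xv) scalerA mulrA divfK ?subr_eq0 // divff ?subr_eq0 //.
  by rewrite scale1r.
rewrite /zero_shift; case: eqP => [->|/eqP zv].
  by rewrite subrr mul0r scale0r Fv0.
by rewrite scalerA mulrA divfK ?subr_eq0 // divff ?subr_eq0 // scale1r.
Unshelve. all: by end_near. Qed.

Section ShiftInvariantSpace.
Variables (C : numClosedFieldType) (p : nat) (Omega : set C).
Variables (P : set (C -> 'cV[C]_p)).
Variables (ip : (C -> 'cV[C]_p) -> (C -> 'cV[C]_p) -> C).
Variable (K : C -> C -> 'M[C]_p).
Hypothesis Omega_sym : forall z, Omega z -> Omega z^*.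
Hypothesis P_rk : rk_pontryagin_space Omega P ip K.
Hypothesis P_analytic : forall F, P F -> analytic_in Omega F.
Hypothesis P_shift :
  forall F G, P F -> P G -> forall v, Omega v -> v <> v^* ->
    F v = 0 -> G v = 0 ->
    [/\ P (zero_shift v F), P (zero_shift v G) &
        ip F G = ip (zero_shift v F) (zero_shift v G)].

Let Pherm : hermitian_form_on P ip.
Proof. by case: (rkp_pontryagin P_rk). Qed.

Lemma zero_shift_vanishing v F : Omega v -> v != v^* ->
  vanishing_at P v F -> vanishing_at P v^* (zero_shift v F).
Proof.
move=> Ov /eqP vr [PF Fv]; have [PS _ _] := P_shift PF PF Ov vr Fv Fv.
split=> //; rewrite /zero_shift; case: eqP => [/esym //|_].
by rewrite subrr mul0r scale0r.
Qed.

Lemma negative_family_shift v k : Omega v -> v != v^* ->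
  negative_family (vanishing_at P v) ip k ->
  negative_family (vanishing_at P v^*) ip k.
Proof.
move=> Ov vr.
apply: (negative_family_isometry (T := zero_shift v)).
- exact: (vanishing_subspace P_rk).
- exact: (vanishing_hermitian P_rk).
- exact: (vanishing_subspace P_rk).
- exact: (vanishing_hermitian P_rk).
move=> F G PF PG; split; [exact: zero_shift_vanishing..|].
by case: PF PG => [PF Fv] [PG Gv]; have [] := P_shift PF PG Ov (elimN eqP vr) Fv Gv.
Qed.

(** If the inequality failed by [d > 0], a negative family in [vanishing_at v]
    could be extended to [P], restricted to [vanishing_at v^*] and shifted back
    with a net gain of [d] members.  Iterating contradicts the finiteness of the
    negative index of [P]. *)
Lemma kernel_negative_index_le v : Omega v -> v != v^* ->
  K v v \in unitmx -> K v^* v^* \in unitmx ->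
  ((signature (K v v)).2 <= (signature (K v^* v^*)).2)%N.
Proof.
move=> Ov vr Kv Kvc; have Ovc := Omega_sym Ov; rewrite leqNgt; apply/negP.
set n := (signature (K v v)).2; set n' := (signature _).2 => ltn.
have vcr : v^* != v^*^* by rewrite conjCK eq_sym.
(* The net gain of one round trip is [n - n']. *)
have grow j : negative_family (vanishing_at P v) ip (j * (n - n')).
  elim: j => [|j IH].
    exists (fun _ => 0); split; first by move=> [].
    by move=> c /eqP[]; apply/colP => -[].
  rewrite -[v in vanishing_at _ v]conjCK; apply: negative_family_shift => //.
  apply: (negative_family_restrict P_rk) => //.
  rewrite -/n' mulSn [(_ - _ + _)%N]addnC -addnA (subnK (ltnW ltn)).
  exact: (negative_family_extend P_rk).
have [N bound] := pontryagin_negative_bound (rkp_pontryagin P_rk).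
have := bound _ (negative_family_extend P_rk Ov (grow N.+1)).
apply/negP; rewrite -ltnNge -/n.
apply: leq_trans (leq_addr _ _).
by rewrite leq_pmulr // subn_gt0.
Qed.

Lemma kernel_negative_index v : Omega v -> v != v^* ->
  K v v \in unitmx -> K v^* v^* \in unitmx ->
  (signature (K v v)).2 = (signature (K v^* v^*)).2.
Proof.
move=> Ov vr Kv Kvc; apply/eqP; rewrite eqn_leq kernel_negative_index_le //=.
have := @kernel_negative_index_le v^*; rewrite conjCK; apply=> //.
  exact: Omega_sym.
by rewrite eq_sym.
Qed.

(** The reproducing kernel of [vanishing_at P v] ([vanishing_reproducing]). *)
Definition vanishing_kernel v z w := K z w - K z v *m invmx (K v v) *m K v w.

Lemma vanishing_kernelE v z w c : Omega v -> Omega z -> Omega w ->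
  kproj Omega K v (kfun Omega K w c) z = vanishing_kernel v z w *m c.
Proof.
move=> Ov Oz Ow; rewrite /kproj !fctE !kfunE //.
by rewrite /vanishing_kernel mulmxBl !mulmxA.
Qed.

Lemma vanishing_kernel_adj v z w : Omega v -> Omega z -> Omega w ->
  (vanishing_kernel v w z)^t* = vanishing_kernel v z w.
Proof.
move=> Ov Oz Ow; rewrite /vanishing_kernel adjmxB !adjmxM adjmx_inv.
by rewrite !(kernel_adj P_rk) // mulmxA.
Qed.

Lemma vanishing_kernel_left v w : K v v \in unitmx -> vanishing_kernel v v w = 0.
Proof. by move=> Kv; rewrite /vanishing_kernel mulmxV // mul1mx subrr. Qed.

Lemma vanishing_kernel_right v z : K v v \in unitmx -> vanishing_kernel v z v = 0.
Proof. by move=> Kv; rewrite /vanishing_kernel mulmxKV // subrr. Qed.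

Lemma vanishing_reproducing v F z d : Omega v -> K v v \in unitmx -> Omega z ->
  vanishing_at P v F ->
  ip F (kproj Omega K v (kfun Omega K z d)) = (d^t* *m F z) 0 0.
Proof.
move=> Ov Kv Oz vF; have [PF Fv] := vF.
have e : kfun Omega K z d = kproj Omega K v (kfun Omega K z d)
    + kfun Omega K v (invmx (K v v) *m kfun Omega K z d v).
  by rewrite /kproj subrK.
have Psub : linear_subspace P by case: (rkp_pontryagin P_rk).
rewrite -(reproducing P_rk d PF Oz) [in RHS]e.
have [Pu _] := kproj_vanishing P_rk Ov Kv (kfunP P_rk d Oz).
rewrite (form_addr Psub Pherm Pu (kfunP P_rk _ Ov) PF).
by rewrite [ip F (kfun _ _ v _)](vanishing_orth P_rk) // addr0.
Qed.

Section Nonreal.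
Variable a : C.
Hypotheses (Oa : Omega a) (ar : a != a^*).
Hypotheses (Ka : K a a \in unitmx) (Kb : K a^* a^* \in unitmx).

Let b := a^*.

(** Pair the shift of [G], the projected kernel function at [w], with [H], the
    projected kernel function at [z].  The reproducing property of [H] evaluates
    the shift of [G] at [z]; after shifting both sides back, that of [G]
    evaluates the inverse shift of [H] at [w]. *)
Lemma vanishing_kernel_shift z w : Omega z -> Omega w ->
  ((z - b) * (w^* - a)) *: vanishing_kernel a z w
  = ((z - a) * (w^* - b)) *: vanishing_kernel b z w.
Proof.
move=> Oz Ow; have Ob : Omega b := Omega_sym Oa.
(* Where a shift would be evaluated at its pole, both sides vanish. *)
have [->|za] := eqVneq z a.
  by rewrite vanishing_kernel_left // subrr mul0r scaler0 scale0r.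
have [->|wb] := eqVneq w b.
  by rewrite vanishing_kernel_right // conjCK subrr mulr0 scaler0 scale0r.
have br : b != b^* by rewrite conjCK eq_sym.
suff E : ((z - b) / (z - a)) *: vanishing_kernel a z w
       = (((w - a) / (w - b))^*) *: vanishing_kernel b z w.
  have wa : w^* - a != 0.
    by rewrite subr_eq0; apply: contra wb => /eqP wa; rewrite /b -wa conjCK.
  have za0 : z - a != 0 by rewrite subr_eq0.
  have -> : (z - b) * (w^* - a) = ((z - a) * (w^* - a)) * ((z - b) / (z - a)).
    by rewrite [RHS]mulrC [RHS]mulrA divfK.
  rewrite -scalerA E scalerA; congr (_ *: _); rewrite rmorphM fmorphV !rmorphB /=.
  rewrite -/b [b^*]conjCK.
  by rewrite -mulrA [(w^* - a) * _]mulrC divfK.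

apply: mx_sesqui_eq => c d.
pose G := kproj Omega K a (kfun Omega K w c).
pose H := kproj Omega K b (kfun Omega K z d).
have vG : vanishing_at P a G by exact: (kproj_vanishing P_rk) (kfunP P_rk _ _).
have vH : vanishing_at P b H by exact: (kproj_vanishing P_rk) (kfunP P_rk _ _).
have vSG := zero_shift_vanishing Oa ar vG.
have vSH := zero_shift_vanishing Ob br vH.
have SSG : zero_shift b (zero_shift a G) = G.
  apply: zero_shift_cancel ar vG.2 _.
  exact: (P_analytic vG.1 Ob).
have E1 : ip (zero_shift a G) H = (d^t* *m zero_shift a G z) 0 0.
  exact: vanishing_reproducing.
have E2 : ip (zero_shift a G) H = ((c^t* *m zero_shift b H w) 0 0)^*.
  have [_ _ ->] := P_shift vSG.1 vH.1 Ob (elimN eqP br) vSG.2 vH.2.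
  rewrite -/b SSG Pherm.2; [|exact: vG.1|exact: vSH.1].
  congr (_^*); apply: vanishing_reproducing => //.
  by rewrite /b conjCK in vSH.
have adj00 (x : 'M[C]_1) : (x 0 0)^* = (x^t*) 0 0 by rewrite !mxE.
move: E1; rewrite E2 adj00 !adjmxM trmxCK /zero_shift (negPf za) (negPf wb).
rewrite -/b [b^*]conjCK /G /H !vanishing_kernelE // adjmxZ adjmxM.
by rewrite vanishing_kernel_adj // -!scalemxAr -!scalemxAl !mulmxA => ->.
Qed.

Lemma kernel_identity z w : Omega z -> Omega w ->
  ((a - b) * (z - w^*)) *: K z w
  = ((z - a) * (w^* - b)) *: (K z b *m invmx (K b b) *m K b w)
  - ((z - b) * (w^* - a)) *: (K z a *m invmx (K a a) *m K a w).
Proof.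
move=> Oz Ow; have := vanishing_kernel_shift Oz Ow.
rewrite /vanishing_kernel !scalerBr => E.
have -> : (a - b) * (z - w^*) = (z - a) * (w^* - b) - (z - b) * (w^* - a).
  by move: (w^*) => x; ring.
rewrite scalerBl; move: E.
move: (_ *: _) (_ *: _) (_ *: K z w) (_ *: K z w) => X Y B A E.
by rewrite -[B](subrK X) -E addrAC [A - Y]addrC addrK addrC.
Qed.

(** Split the positive number [r^-1] into two equal factors [sqrtC r^-1], one
    for [z] and one for [w]. *)
Lemma kernel_factorization : 0 < 'i * (a - b) ->
  let J := sign_mx C p (signature (K a a)).2 in
  exists Ep Em : C -> 'M[C]_p, forall z w, Omega z -> Omega w ->
    Ep z *m J *m (Ep w)^t* - Em z *m J *m (Em w)^t*
    = (- 'i * (z - w^*)) *: K z w.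
Proof.
move=> r0 J; set r := 'i * (a - b) in r0; have Ob : Omega b := Omega_sym Oa.
have [Ya Ea] := hermitian_inverse_sign (kernel_adj P_rk Oa Oa) Ka.
have [Yb Eb] := hermitian_inverse_sign (kernel_adj P_rk Ob Ob) Kb.
rewrite -/J in Ea; rewrite -(kernel_negative_index Oa ar Ka Kb) -/J in Eb.
pose q := sqrtC r^-1.
have qq : q * q^* = r^-1.
  by rewrite geC0_conj ?sqrtC_ge0 ?invr_ge0 ?ltW // -expr2 sqrtCK.
have term u v Y z w : Omega v -> Omega w -> invmx (K v v) = Y *m J *m Y^t* ->
    ((q * (z - u)) *: (K z v *m Y)) *m J *m ((q * (w - u)) *: (K w v *m Y))^t*
    = r^-1 *: (((z - u) * (w^* - u^*)) *: (K z v *m invmx (K v v) *m K v w)).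
  move=> Ov Ow EY; rewrite adjmxZ adjmxM (kernel_adj P_rk) //.
  rewrite -!scalemxAl -scalemxAr !scalerA EY !mulmxA; congr (_ *: _).
  rewrite -qq rmorphM rmorphB /=; move: q^* u^* w^* => x y t; ring.
exists (fun z => (q * (z - a)) *: (K z b *m Yb)).
exists (fun z => (q * (z - b)) *: (K z a *m Ya)) => z w Oz Ow.
rewrite !term // -scalerBr -[a^*]/b {1}/b conjCK -kernel_identity // scalerA.
congr (_ *: _); rewrite mulrA; congr (_ * _).
have ab : a - b != 0 by rewrite subr_eq0.
by rewrite /r invfM divfK // invCi.
Qed.

End Nonreal.
End ShiftInvariantSpace.

Theorem theorem10p1 (R : realType) (p : nat) (Omega : set (Cnum R))
    (P : set (Cnum R -> 'cV[Cnum R]_p))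
    (ip : (Cnum R -> 'cV[Cnum R]_p) -> (Cnum R -> 'cV[Cnum R]_p) -> Cnum R)
    (K : Cnum R -> Cnum R -> 'M[Cnum R]_p) (alpha : Cnum R)
    (Omega_open : open Omega)
    (Omega_sym : forall z, Omega z -> Omega z^*)
    (Omega_real : exists2 x, Omega x & x \is Num.real)
    (P_rk : rk_pontryagin_space Omega P ip K)
    (P_analytic : forall F, P F -> analytic_in Omega F)
    (alpha_in : Omega alpha)
    (alpha_nonreal : alpha <> alpha^*)
    (K_alpha : K alpha alpha \in unitmx)
    (K_alphaC : K alpha^* alpha^* \in unitmx)
    (P_shift : forall F G, P F -> P G -> forall v, Omega v -> v <> v^* ->
       F v = 0 -> G v = 0 ->
       [/\ P (zero_shift v F), P (zero_shift v G) &
           ip F G = ip (zero_shift v F) (zero_shift v G)]) :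
  exists (Ep Em : Cnum R -> 'M[Cnum R]_p) (J : 'M[Cnum R]_p),
    [/\ signature_matrix J,
        signature J = signature (K alpha alpha) &
        forall z w, Omega z -> Omega w ->
          let N := Ep z *m J *m (Ep w)^t* - Em z *m J *m (Em w)^t* in
          (z <> w^* -> K z w = (- 'i * (z - w^*))^-1 *: N) /\
          (z = w^* -> N = 0)].
Proof.
have ar : alpha != alpha^* by apply/eqP.
have Oac := Omega_sym _ alpha_in.
pose J := sign_mx (Cnum R) p (signature (K alpha alpha)).2.
suff [Ep [Em EN]] : exists Ep Em : Cnum R -> 'M[Cnum R]_p,
    forall z w, Omega z -> Omega w ->
    Ep z *m J *m (Ep w)^t* - Em z *m J *m (Em w)^t*
    = (- 'i * (z - w^*)) *: K z w.
  exists Ep, Em, J; split; first exact: sign_mx_signature.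
    by rewrite hermitian_signature // (kernel_adj P_rk).
  move=> z w Oz Ow N; rewrite /N EN //; split=> [/eqP zw|->].
    by rewrite scalerA mulVf ?scale1r // mulf_neq0 ?oppr_eq0 ?neq0Ci ?subr_eq0.
  by rewrite subrr mulr0 scale0r.
(* The factorization applies to one of the two conjugate points: the one in the
   lower half plane, where ['i * (a - a^* )] is positive. *)
have fact a := kernel_factorization Omega_sym P_rk P_analytic P_shift (a := a).
have r_real : 'i * (alpha - alpha^*) \is Num.real.
  apply/CrealP; rewrite rmorphM rmorphB /= conjCi conjCK.
  by rewrite mulNr -mulrN opprB.
have r_neq0 : 'i * (alpha - alpha^*) != 0.
  by rewrite mulf_neq0 ?neq0Ci ?subr_eq0.
have [r0|r0|/eqP] := real_ltgt0P r_real; last by rewrite (negPf r_neq0).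
  exact: fact.
rewrite /J (kernel_negative_index Omega_sym P_rk P_shift alpha_in ar) //.
apply: fact => //; rewrite ?conjCK //; first by rewrite eq_sym.
by rewrite -opprB mulrN oppr_gt0.
Qed.
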